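(* Let $\mathrm{R}$ be a real closed field, $\mathrm{C}=\mathrm{R}[i]$, let $F/G \in \mathrm{C}(Z)\setminus\{0\}$ and let $\Gamma=[x_0,x_1]\times[y_0,y_1]\subset \mathrm{R}^2$ with $x_0<x_1$, $y_0<y_1$, such that $\mathrm{val}_z(F/G)$ is even for each of the four vertices $z$ of $\Gamma$. Then $$\mathrm{w}(F/G \mid \partial\Gamma)=\sum_{z\in\Gamma} c_\Gamma(z)\,\mathrm{val}_z(F/G),$$ where $c_\Gamma(z)=1$ if $z$ is in the interior of $\Gamma$, $c_\Gamma(z)=\tfrac12$ if $z$ lies on an edge but is not a vertex, and $c_\Gamma(z)=\tfrac14$ if $z$ is a vertex. In words: $\mathrm{w}(F/G\mid\partial\Gamma)$ counts zeros (with multiplicity) minus poles (with order) of $F/G$ in $\Gamma$, those on edges counting one half and those at vertices one quarter.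
   Context: Points $(x,y)\in\mathrm{R}^2$ are identified with $x+iy\in\mathrm{C}$. For nonzero $P\in\mathrm{R}[X]$ and $x\in\mathrm{R}$ write uniquely $P=(X-x)^{\mathrm{mult}_x(P)}P_x$ with $P_x(x)\neq0$; for $P,Q\neq0$ set $\mathrm{val}_x(P/Q)=\mathrm{mult}_x(P)-\mathrm{mult}_x(Q)$. For $P,Q\in\mathrm{R}[X]$, $x\in\mathrm{R}$: $\mathrm{Ind}^+_x(P,Q)=\tfrac12\,\mathrm{sign}(P_x(x)Q_x(x))$ and $\mathrm{Ind}^-_x(P,Q)=\tfrac12(-1)^{\mathrm{val}_x(P/Q)}\mathrm{sign}(P_x(x)Q_x(x))$ if $P\ne0$, $Q\neq0$ and $\mathrm{val}_x(P/Q)<0$, and both are $0$ otherwise; $\mathrm{Ind}_x=\mathrm{Ind}^+_x-\mathrm{Ind}^-_x$. For $a<b$, $\mathrm{Ind}_a^b(P,Q)=\mathrm{Ind}_a^+(P,Q)+\sum_{x\in(a,b)}\mathrm{Ind}_x(P,Q)-\mathrm{Ind}_b^-(P,Q)$; $\mathrm{Ind}_a^b=-\mathrm{Ind}_b^a$ if $b<a$, and $\mathrm{Ind}_a^a=0$. For $F\in\mathrm{C}[X,Y]$ let $F_{\rm re},F_{\rm im}\in\mathrm{R}[X,Y]$ with $F=F_{\rm re}+iF_{\rm im}$, and $\overline F=F_{\rm re}-iF_{\rm im}$. Define $\mathrm{w}(F\mid\partial\Gamma)=\tfrac12\big(\mathrm{Ind}_{x_0}^{x_1}(F_{\rm re}(T,y_0),F_{\rm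 im}(T,y_0))+\mathrm{Ind}_{y_0}^{y_1}(F_{\rm re}(x_1,T),F_{\rm im}(x_1,T))+\mathrm{Ind}_{x_1}^{x_0}(F_{\rm re}(T,y_1),F_{\rm im}(T,y_1))+\mathrm{Ind}_{y_1}^{y_0}(F_{\rm re}(x_0,T),F_{\rm im}(x_0,T))\big)$. $\mathrm{C}[Z]\subset\mathrm{C}[X,Y]$ via $Z=X+iY$. For $F,G\in\mathrm{C}[X,Y]$, $G\neq0$, $\mathrm{w}(F/G\mid\partial\Gamma):=\mathrm{w}(F\overline G\mid\partial\Gamma)$ (independent of the representation). For nonzero $F\in\mathrm{C}[Z]$, $z\in\mathrm{C}$ write $F=(Z-z)^{\mathrm{mult}_z(F)}F_z$ with $F_z(z)\ne0$, and $\mathrm{val}_z(F/G)=\mathrm{mult}_z(F)-\mathrm{mult}_z(G)$ for $F,G\ne0$. *)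

(* Defs.v *)
From HB Require Import structures.
From mathcomp Require Import all_boot all_order all_algebra.
From mathcomp Require Import polyrcf complex.
From mathcomp Require Import boolp classical_sets fsbigop.
Set Implicit Arguments. Unset Strict Implicit. Unset Printing Implicit Defensive.
Import Order.TTheory GRing.Theory Num.Theory.
Local Open Scope ring_scope.

Section Defs.
Variable R : rcfType.
Local Notation C := (complex R).

Definition multR (x : R) (P : {poly R}) : nat := mup x P.
Definition cofR (x : R) (P : {poly R}) : {poly R} := P %/ ('X - x%:P) ^+ multR x P.
Definition valR (x : R) (P Q : {poly R}) : int := (multR x P)%:Z - (multR x Q)%:Z.

Definition Indp (x : R) (P Q : {poly R}) : R :=
  if [&& P != 0, Q != 0 & valR x P Q < 0] then
    2^-1 * Num.sg ((cofR x P).[x] * (cofR x Q).[x])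
  else 0.
Definition Indm (x : R) (P Q : {poly R}) : R :=
  if [&& P != 0, Q != 0 & valR x P Q < 0] then
    2^-1 * ((-1) ^ valR x P Q) * Num.sg ((cofR x P).[x] * (cofR x Q).[x])
  else 0.
Definition Indx (x : R) (P Q : {poly R}) : R := Indp x P Q - Indm x P Q.

(** Ind_a^b for a < b; the sum over x in (a,b) is over the roots of Q in
    (a,b), the only points where Ind_x can be nonzero. *)
Definition Ind_lt (a b : R) (P Q : {poly R}) : R :=
  Indp a P Q + \sum_(x <- roots Q a b) Indx x P Q - Indm b P Q.
Definition Ind (a b : R) (P Q : {poly R}) : R :=
  if a < b then Ind_lt a b P Q
  else if b < a then - Ind_lt b a P Q
  else 0.

(** Restriction of H(X,Y) = F(X+iY) * conj(G)(X,Y) to the line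
    t |-> a + b t (t real), as a polynomial in C[T]:
    F(a + b T) * (conj-coeff G)(a^* + b^* T).  Its real and imaginary
    parts (coefficientwise) are H_re, H_im restricted to the line. *)
Definition line_poly (F G : {poly C}) (a b : C) : {poly C} :=
  (F \Po (a%:P + b%:P * 'X)) *
  ((map_poly (@conjc R) G) \Po ((conjc a)%:P + (conjc b)%:P * 'X)).
Definition pre (P : {poly C}) : {poly R} := map_poly (@complex.Re R) P.
Definition pim (P : {poly C}) : {poly R} := map_poly (@complex.Im R) P.

(** w(F/G | dGamma) := w(F * conj G | dGamma). *)
Definition wind (F G : {poly C}) (x0 x1 y0 y1 : R) : R :=
  let h y := line_poly F G (Complex 0 y) (Complex 1 0) in
  let v x := line_poly F G (Complex x 0) (Complex 0 1) in
  2^-1 * ( Ind x0 x1 (pre (h y0)) (pim (h y0))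
         + Ind y0 y1 (pre (v x1)) (pim (v x1))
         + Ind x1 x0 (pre (h y1)) (pim (h y1))
         + Ind y1 y0 (pre (v x0)) (pim (v x0)) ).

Definition valC (z : C) (F G : {poly C}) : int :=
  (mup z F)%:Z - (mup z G)%:Z.

Definition rect (x0 x1 y0 y1 : R) : set C :=
  [set z | x0 <= complex.Re z <= x1 /\ y0 <= complex.Im z <= y1].
Definition cGamma (x0 x1 y0 y1 : R) (z : C) : R :=
  if (x0 < complex.Re z < x1) && (y0 < complex.Im z < y1) then 1
  else if ((complex.Re z == x0) || (complex.Re z == x1)) && ((complex.Im z == y0) || (complex.Im z == y1))
  then 4^-1 else 2^-1.

End Defs.

(* Main.v *)
(* Idea: the Cauchy index of a curve [H] on a segment counts the half-turns of
   its argument up to endpoint corrections, so that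
   [Ind (H1 * H2) = Ind H1 + Ind H2 + k(start) - k(end)], where
   [k = sg (Im u1 * Im u2 * Im (u1 * u2)) / 2] depends only on the tangent
   directions [u1], [u2] up to real factors. At a point [z] where the valuation
   is even, the directions along the two sides of the rectangle differ by a
   real factor, so the corrections cancel around the boundary and the winding
   number is multiplicative. Removing common roots and exchanging [F] and [G],
   we reduce to [Z - z], computed by hand, and to [(Z - z)^2] for a vertex [z]. *)

Require Import Defs.
From HB Require Import structures.
From mathcomp Require Import all_boot all_order all_algebra.
From mathcomp Require Import polyrcf complex.
From mathcomp Require Import boolp classical_sets fsbigop.
From mathcomp Require Import cardinality zify ring lra.
Set Implicit Arguments. Unset Strict Implicit. Unset Printing Implicit Defensive.
Import Order.TTheory GRing.Theory Num.Theory.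
Local Open Scope ring_scope.

(** * One-sided signs and one-sided Cauchy indices of real polynomials *)

Lemma mup_cofactor (F : fieldType) (x : F) (q : {poly F}) : q != 0 ->
  exists2 r, q = ('X - x%:P) ^+ mup x q * r & r.[x] != 0.
Proof.
move=> q0; have [m [r]] := multiplicity_XsubC q x; rewrite q0 /= => rx qE.
exists r => //; rewrite qE mupMr// mup_XsubCX eqxx; exact: mulrC.
Qed.

Section OneSidedSign.
Variable R : rcfType.
Implicit Types (b : bool) (x t : R) (P Q W : {poly R}).

Lemma mup_factor x (m : nat) Q : Q.[x] != 0 -> mup x (('X - x%:P) ^+ m * Q) = m.
Proof. by move=> Qx; rewrite mupMl // mup_XsubCX eqxx. Qed.

Lemma cofR_factor x (m : nat) Q : Q.[x] != 0 ->
  cofR x (('X - x%:P) ^+ m * Q) = Q.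
Proof.
move=> Qx; rewrite /cofR /multR mup_factor// mulrC mulpK //.
by rewrite expf_neq0 // polyXsubC_eq0.
Qed.

(* The sign of [Q] immediately to the right ([b = false]) or left ([b = true]) of [x]. *)
Definition sgside b x Q : R :=
  ((-1) ^+ b) ^+ mup x Q * Num.sg (cofR x Q).[x].

Lemma sgside_factor b x m Q : Q.[x] != 0 ->
  sgside b x (('X - x%:P) ^+ m * Q) = ((-1) ^+ b) ^+ m * Num.sg Q.[x].
Proof. by move=> Qx; rewrite /sgside cofR_factor // mup_factor. Qed.

Lemma sgside0 b x : sgside b x 0 = 0.
Proof. by rewrite /sgside /cofR div0p horner0 sgr0 mulr0. Qed.

Lemma sgside_nonroot b x Q : Q.[x] != 0 -> sgside b x Q = Num.sg Q.[x].
Proof.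
by move=> Qx; rewrite -[Q in LHS]mul1r -(expr0 ('X - x%:P)) sgside_factor // mul1r.
Qed.

Lemma sgsideM b x P Q : sgside b x (P * Q) = sgside b x P * sgside b x Q.
Proof.
have [->|P0] := eqVneq P 0; first by rewrite mul0r sgside0 mul0r.
have [->|Q0] := eqVneq Q 0; first by rewrite mulr0 sgside0 mulr0.
have [p -> px] := mup_cofactor x P0.
have [q -> qx] := mup_cofactor x Q0.
rewrite mulrACA -exprD !sgside_factor // ?hornerM ?mulf_neq0 //.
by rewrite exprD sgrM mulrACA.
Qed.

Lemma sgside_eq0 b x Q : (sgside b x Q == 0) = (Q == 0).
Proof.
have [->|Q0] := eqVneq Q 0; first by rewrite sgside0 eqxx.
have [q -> qx] := mup_cofactor x Q0.
rewrite sgside_factor // mulf_eq0 sgr_eq0 (negbTE qx) orbF.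
by rewrite expf_eq0 signr_eq0 andbF.
Qed.

Lemma sgside_sg b x Q : Q != 0 -> sgside b x Q = 1 \/ sgside b x Q = -1.
Proof.
move=> Q0; have [q -> qx] := mup_cofactor x Q0.
rewrite sgside_factor // -exprM -signr_odd.
by case: (sgrP q.[x]) qx; rewrite ?eqxx // => _ _; case: odd;
  rewrite ?expr1 ?expr0 ?mulr1 ?mul1r ?mulrNN ?mulr1; auto.
Qed.

Lemma sgside_sqr b x Q : Q != 0 -> sgside b x Q * sgside b x Q = 1.
Proof. by move=> /(sgside_sg b x)[] ->; rewrite ?mulr1 ?mulrNN ?mulr1. Qed.

(** Near [x] the summand of smaller multiplicity dominates; for equal multiplicities the equal signs
    exclude cancellation of the lowest terms. *)
Lemma sgside_add b x P Q :
  sgside b x P = sgside b x Q -> sgside b x (P + Q) = sgside b x P.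
Proof.
have wl P' Q' : (mup x P' <= mup x Q')%N -> P' != 0 -> Q' != 0 ->
    sgside b x P' = sgside b x Q' -> sgside b x (P' + Q') = sgside b x P'.
  move=> + P0 Q0; move: (mup x P') (mup x Q')
    (mup_cofactor x P0) (mup_cofactor x Q0).
  move=> m n [p -> px] [q -> qx] mn.
  rewrite -(subnKC mn) exprD -mulrA -mulrDr !mulrA -exprD.
  rewrite subnKC // (@sgside_factor _ _ _ p) // (@sgside_factor _ _ _ q) //.
  move: mn; rewrite leq_eqVlt => /orP[/eqP <-|mn].
    rewrite subnn expr0 mul1r => /mulfI e.
    have {}e : Num.sg p.[x] = Num.sg q.[x].
      by apply: e; rewrite expf_neq0 // signr_eq0.
    have s : Num.sg (p + q).[x] = Num.sg p.[x].
      rewrite hornerD; move: e px qx; case: (sgrP p.[x]) => // hp;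
      case: (sgrP q.[x]) => // hq; rewrite ?eqxx // => e _ _.
      - by rewrite gtr0_sg // addr_gt0.
      - by lra.
      - by lra.
      - by rewrite ltr0_sg // addrC ltr_nDr // ltW.
    by rewrite sgside_factor ?s // -sgr_eq0 s sgr_eq0.
  move=> _; have e : (p + ('X - x%:P) ^+ (n - m) * q).[x] = p.[x].
    by rewrite hornerD hornerM horner_exp hornerXsubC subrr expr0n subn_eq0
      leqNgt mn mul0r addr0.
  by rewrite sgside_factor e.
have [->|P0] := eqVneq P 0.
  by rewrite sgside0 => /esym/eqP; rewrite sgside_eq0 => /eqP ->; rewrite addr0 sgside0.
have [->|Q0] := eqVneq Q 0; first by rewrite addr0.
move=> e; case: (leqP (mup x P) (mup x Q)) => h; first exact: wl.
by rewrite addrC e; apply: wl => //; apply: ltnW.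
Qed.

(** One formula for $\mathrm{Ind}^+$ ([b = false]) and $\mathrm{Ind}^-$ ([b = true]): the factor
    $(-1)^{\mathrm{val}}$ of the latter is absorbed by the two left-hand signs. *)
Definition Indside b x P Q : R :=
  if [&& P != 0, Q != 0 & (mup x P < mup x Q)%N] then
    2^-1 * (sgside b x P * sgside b x Q)
  else 0.

Lemma valR_lt0 x P Q : (valR x P Q < 0) = (mup x P < mup x Q)%N.
Proof. by rewrite /valR /multR subr_lt0 ltz_nat. Qed.

Lemma IndpE x P Q : Indp x P Q = Indside false x P Q.
Proof.
by rewrite /Indp /Indside valR_lt0 /sgside expr0 !expr1n !mul1r sgrM.
Qed.

Lemma IndmE x P Q : Indm x P Q = Indside true x P Q.
Proof.
rewrite /Indm /Indside valR_lt0 /sgside expr1 sgrM.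
case: ifP => // _; rewrite /valR /multR -mulrA; congr (_ * _).
rewrite expfzDr ?oppr_eq0 ?oner_eq0 // -invr_expz -exprnP -exprVn invrN1.
by rewrite mulrACA.
Qed.

(** A common factor shifts both multiplicities equally, and its one-sided sign enters squared.
    Common zeros of real and imaginary part can thus be removed. *)
Lemma Indside_scale b x m P Q :
  Indside b x (('X - x%:P) ^+ m * P) (('X - x%:P) ^+ m * Q) = Indside b x P Q.
Proof.
have X0 : ('X - x%:P) ^+ m != 0 :> {poly R} by rewrite expf_neq0 // polyXsubC_eq0.
rewrite /Indside !mulf_eq0 (negbTE X0) /=.
have [//|P0] := eqVneq P 0; have [//|Q0] := eqVneq Q 0.
by rewrite !mupM // ltn_add2l !sgsideM mulrACA sgside_sqr // mul1r.
Qed.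

(** The multiplicity condition reduces to [Q.[x] = 0]; the formula also covers [Q = 0], where
    [sgside] is 0. *)
Lemma Indside_val b x P Q : (P.[x] != 0) || (Q.[x] != 0) ->
  Indside b x P Q = if Q.[x] == 0 then 2^-1 * (Num.sg P.[x] * sgside b x Q) else 0.
Proof.
rewrite /Indside; have [Qx|Qx] := eqVneq Q.[x] 0.
  rewrite orbF => Px; have P0 : P != 0 by apply: contraNneq Px => ->; rewrite horner0.
  rewrite P0 /= (@sgside_nonroot _ _ P) // mupNroot //.
  have [->|Q0] := eqVneq Q 0; first by rewrite sgside0 !mulr0.
  by rewrite -XsubC_dvd // dvdp_XsubCl /root Qx eqxx.
by move=> _; rewrite (@mupNroot _ _ Q) // ltn0 !andbF.
Qed.

(* For [u_i = p_i + i q_i] the quantity [- sg (Im u1 * Im u2 * Im (u1 u2)) / 2] is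
   [psi u1 + psi u2 - psi (u1 u2)], where [psi u] is the 1-periodic sawtooth
   function of [arg u / pi]. *)
Lemma Indside_mul b t (p1 q1 p2 q2 : {poly R}) :
  (p1.[t] != 0) || (q1.[t] != 0) -> (p2.[t] != 0) || (q2.[t] != 0) ->
  Indside b t (p1 * p2 - q1 * q2) (p1 * q2 + p2 * q1) =
  Indside b t p1 q1 + Indside b t p2 q2 +
  2^-1 * (Num.sg (q1.[t] * q2.[t] * (p1 * q2 + p2 * q1).[t])
     - sgside b t (q1 * q2 * (p1 * q2 + p2 * q1))).
Proof.
move=> h1 h2; set q := p1 * q2 + p2 * q1; set p := p1 * p2 - _.
have h : (p.[t] != 0) || (q.[t] != 0).
  rewrite -negb_and; apply/negP => /andP[/eqP hp /eqP hq].
  have e : (p1.[t] ^+ 2 + q1.[t] ^+ 2) * (p2.[t] ^+ 2 + q2.[t] ^+ 2) =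
    p.[t] ^+ 2 + q.[t] ^+ 2 by rewrite /p /q !hornerE; ring.
  move: e; rewrite hp hq expr0n addr0 => /eqP; rewrite mulf_eq0 !paddr_eq0 ?sqr_ge0 //.
  by rewrite !sqrf_eq0; move: h1 h2; rewrite -!negb_and => /negbTE -> /negbTE ->.
rewrite !Indside_val // !sgsideM.
have [q1x|q1x] := eqVneq q1.[t] 0; have [q2x|q2x] := eqVneq q2.[t] 0.
- have qx : q.[t] = 0 by rewrite /q !hornerE q1x q2x !mulr0 addr0.
  have px : p.[t] = p1.[t] * p2.[t] by rewrite /p !hornerE q1x mul0r subr0.
  move: h1 h2; rewrite q1x q2x eqxx !orbF => p1x p2x.
  rewrite qx eqxx px mulr0 sgr0 sgrM.
  have E1 : sgside b t (p1 * q2) = Num.sg p1.[t] * sgside b t q2.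
    by rewrite sgsideM (@sgside_nonroot _ _ p1).
  have E2 : sgside b t (p2 * q1) = Num.sg p2.[t] * sgside b t q1.
    by rewrite sgsideM (@sgside_nonroot _ _ p2).
  (* If [p1 * q2] and [p2 * q1] have the same one-sided sign, it is that of [q]; if the signs are
     opposite, the two indices on the right cancel and the identity holds whatever the sign of [q],
     even for [q = 0]. *)
  have := @sgside_add b t (p1 * q2) (p2 * q1); rewrite -/q E1 E2.
  have [z1|z1] := eqVneq q1 0.
    move=> _; rewrite /q z1 mulr0 addr0 E1 sgside0.
    by case: (sgrP p1.[t]) p1x; rewrite ?eqxx // => *; field.
  have [z2|z2] := eqVneq q2 0.
    move=> _; rewrite /q z2 mulr0 add0r E2 sgside0.
    by case: (sgrP p2.[t]) p2x; rewrite ?eqxx // => *; field.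
  have : q = 0 \/ sgside b t q = 1 \/ sgside b t q = -1.
    by have [|/(sgside_sg b t)] := eqVneq q 0; auto.
  case: (sgrP p1.[t]) p1x; rewrite ?eqxx // => _ _;
  case: (sgrP p2.[t]) p2x; rewrite ?eqxx // => _ _;
  case: (sgside_sg b t z1) => ->; case: (sgside_sg b t z2) => ->;
  rewrite ?mulr1 ?mul1r ?mulrNN ?mulr1;
  case => [->|[->|->]]; rewrite ?sgside0 => H; first [lra | by have H0 := H erefl; lra].
- have qx : q.[t] = p1.[t] * q2.[t] by rewrite /q !hornerE q1x mulr0 addr0.
  move: h1; rewrite q1x eqxx orbF => p1x.
  have qx0 : q.[t] != 0 by rewrite qx mulf_neq0.
  rewrite (negbTE qx0) !mul0r sgr0.
  rewrite !(@sgside_nonroot _ _ q2) // (@sgside_nonroot _ _ q) //.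
  rewrite qx sgrM; have := q2x; case: (sgrP q2.[t]); rewrite ?eqxx // => *; lra.
- have qx : q.[t] = p2.[t] * q1.[t] by rewrite /q !hornerE q2x mulr0 add0r.
  move: h2; rewrite q2x eqxx orbF => p2x.
  have qx0 : q.[t] != 0 by rewrite qx mulf_neq0.
  rewrite (negbTE qx0) mulr0 !mul0r sgr0.
  rewrite !(@sgside_nonroot _ _ q1) // (@sgside_nonroot _ _ q) //.
  rewrite qx sgrM; have := q1x; case: (sgrP q1.[t]); rewrite ?eqxx // => *; lra.
rewrite !(@sgside_nonroot _ _ q2) // !(@sgside_nonroot _ _ q1) //.
have [qx|qx] := eqVneq q.[t] 0; last first.
  by rewrite (@sgside_nonroot _ _ q) // !sgrM subrr mulr0 !addr0.
rewrite qx mulr0 sgr0.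
(* Here $u_1u_2$ is real, so $p_2/q_2=-p_1/q_1$ and $p=-q_1q_2((p_1/q_1)^2+1)$. *)
suff -> : Num.sg p.[t] = - (Num.sg q1.[t] * Num.sg q2.[t]) by field.
rewrite -sgrM -sgrN.
have -> : p.[t] = - (q1.[t] * q2.[t]) * ((p1.[t] / q1.[t]) ^+ 2 + 1).
  have e : p2.[t] = - (p1.[t] * q2.[t]) / q1.[t].
    apply: (canRL (mulfK q1x)); apply/eqP; rewrite -subr_eq0 opprK addrC; apply/eqP.
    by rewrite -qx /q !hornerE.
  by rewrite /p !hornerE e; field.
by rewrite sgrM (gtr0_sg (_ : 0 < _ ^+ 2 + 1)) ?mulr1 // ltr_wpDl ?sqr_ge0.
Qed.

(** With the factors at [a] and [b] split off, the rest has no root on the closed interval and keeps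
    its sign; $(x-b)^n$ has sign $(-1)^n$ both at [a] and just left of [b]. *)
Lemma sgside_gap (a b : R) W : a < b -> {in `]a, b[, forall x, ~~ root W x} ->
  sgside false a W = sgside true b W.
Proof.
move=> ab nr; have W0 : W != 0.
  by apply/eqP => W0; have := nr _ (mid_in_itvoo ab); rewrite W0 root0.
have [W1 eW W1a] := mup_cofactor a W0; move: eW; move: (mup a W) => m eW.
have W10 : W1 != 0 by apply: contraNneq W1a => ->; rewrite horner0.
have [W2 eW1 W2b] := mup_cofactor b W10; move: eW1; move: (mup b W1) => n eW1.
have Wx x : W.[x] = (x - a) ^+ m * ((x - b) ^+ n * W2.[x]).
  by rewrite eW eW1 !hornerM !horner_exp !hornerXsubC.
have W2a : W2.[a] != 0.
  by apply: contraNneq W1a => h; rewrite eW1 hornerM h mulr0.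
have s : Num.sg W2.[a] = Num.sg W2.[b].
  apply: (@polyrN0_itv _ `[a, b]); rewrite ?in_itv /= ?lexx ?ltW //.
  move=> x; rewrite in_itv /= => /andP[ax xb]; apply/negP => /eqP rx.
  have [xa|xa] := eqVneq x a; first by rewrite -xa rx eqxx in W2a.
  have [xb'|xb'] := eqVneq x b; first by rewrite -xb' rx eqxx in W2b.
  have /nr : x \in `]a, b[ by rewrite in_itv /= !lt_neqAle ax xb eq_sym xa xb'.
  by rewrite /root Wx rx !mulr0 eqxx.
have -> : sgside false a W = Num.sg (W1.[a]).
  by rewrite eW sgside_factor // expr0 expr1n mul1r.
have -> : sgside true b W = (-1) ^+ n * Num.sg W2.[b].
  rewrite eW sgsideM eW1 sgside_factor // sgside_nonroot.
    by rewrite horner_exp hornerXsubC gtr0_sg ?mul1r // exprn_gt0 // subr_gt0.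
  by rewrite horner_exp hornerXsubC expf_neq0 // subr_eq0 gt_eqF.
rewrite eW1 hornerM horner_exp hornerXsubC sgrM sgrX s.
by rewrite [Num.sg (a - b)]ltr0_sg // subr_lt0.
Qed.

(** The right-hand sign at one point of [s] is the left-hand sign at the next, so the sum collapses.
    Since [s] may contain non-roots, one list can serve several polynomials. *)
Lemma sgside_telescope (s : seq R) (a b : R) W :
  a < b -> path <%R a s -> all (< b) s ->
  {in `]a, b[, forall x, root W x -> x \in s} ->
  sgside false a W + \sum_(x <- s) (sgside false x W - sgside true x W)
    = sgside true b W.
Proof.
elim: s a => [|y s IH] a ab /=.
  by move=> _ _ nr; rewrite big_nil addr0; apply: sgside_gap => //
    x /nr h; apply/negP => /h.
move=> /andP[ay ys] /andP[yb sb] nr; rewrite big_cons.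
rewrite (@sgside_gap a y) //.
  rewrite addrA [X in X + _]addrCA subrr addr0; apply: IH => //.
  move=> x; rewrite in_itv /= => /andP[yx xb] rx.
  have := nr x; rewrite in_itv /= xb (lt_trans ay yx) => /(_ isT rx).
  by rewrite inE (gt_eqF yx).
move=> x; rewrite in_itv /= => /andP[ax xy]; apply/negP => rx.
have := nr x; rewrite in_itv /= ax (lt_trans xy yb) => /(_ isT rx).
rewrite inE (lt_eqF xy) /= => xs.
by have /allP/(_ _ xs) := order_path_min lt_trans ys; rewrite ltNge (ltW xy).
Qed.

Lemma IndxE x P Q : Indx x P Q = Indside false x P Q - Indside true x P Q.
Proof. by rewrite /Indx IndpE IndmE. Qed.

Lemma Indx_nonroot x P Q : Q.[x] != 0 -> Indx x P Q = 0.
Proof. by move=> Qx; rewrite IndxE /Indside (@mupNroot _ _ Q) // ltn0 !andbF subrr. Qed.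

Lemma Indx0 x P : Indx x P 0 = 0.
Proof. by rewrite IndxE /Indside eqxx andbF subrr. Qed.

(** Non-roots of [Q] contribute 0, so sums over different root lists can be moved to one common
    list. For [Q = 0] every [Indx] is 0. *)
Lemma sum_Indx (s : seq R) (a b : R) P Q : uniq s -> {subset s <= `]a, b[} ->
  (Q != 0 -> {in `]a, b[, forall x, root Q x -> x \in s}) ->
  \sum_(x <- roots Q a b) Indx x P Q = \sum_(x <- s) Indx x P Q.
Proof.
move=> us sab; have [->|Q0 /(_ isT) rs] := eqVneq Q 0.
  by rewrite roots0 big_nil big1 // => x _; rewrite Indx0.
rewrite [RHS](bigID (fun x => root Q x)) /= [X in _ + X]big1 ?addr0; last first.
  by move=> x /Indx_nonroot.
rewrite -[RHS]big_filter; apply: perm_big; apply: uniq_perm.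
- exact: uniq_roots.
- exact: filter_uniq.
move=> x; rewrite mem_filter in_roots Q0 andbT.
by apply: andb_id2l => rx; apply/idP/idP => [xab|/sab //]; apply: rs.
Qed.
End OneSidedSign.

(** * Complex curves and the product formula on a segment *)

Section ComplexParts.
Variable R : rcfType.
Local Notation C := (complex R).
Local Notation Re := (@complex.Re R).
Local Notation Im := (@complex.Im R).
Local Notation rc := (real_complex R).
Implicit Types (H K F G : {poly C}) (t : R).

Lemma coef_pre H i : (pre H)`_i = Re H`_i. Proof. by rewrite coef_map_id0. Qed.
Lemma coef_pim H i : (pim H)`_i = Im H`_i. Proof. by rewrite coef_map_id0. Qed.

Lemma ReD (x y : C) : Re (x + y) = Re x + Re y. Proof. by case: x; case: y. Qed.
Lemma ImD (x y : C) : Im (x + y) = Im x + Im y. Proof. by case: x; case: y. Qed.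
Lemma ReM (x y : C) : Re (x * y) = Re x * Re y - Im x * Im y.
Proof. by case: x; case: y. Qed.
Lemma ImM (x y : C) : Im (x * y) = Re x * Im y + Re y * Im x.
Proof. by case: x => a b; case: y => c d; rewrite /= [c * b]mulrC. Qed.

Lemma pre_mul H K : pre (H * K) = pre H * pre K - pim H * pim K.
Proof.
apply/polyP => i; rewrite coef_pre !(coefM, coefB) (big_morph Re ReD erefl) -sumrB.
by apply: eq_bigr => j _; rewrite !coef_pre !coef_pim ReM.
Qed.

Lemma pim_mul H K : pim (H * K) = pre H * pim K + pre K * pim H.
Proof.
apply/polyP => i; rewrite coef_pim [pre K * _]mulrC !(coefM, coefD).
rewrite (big_morph Im ImD erefl) -big_split /=.
by apply: eq_bigr => j _; rewrite !coef_pre !coef_pim ImM [_ * Im H`_j]mulrC.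
Qed.

Lemma pre_map (p : {poly R}) : pre (map_poly rc p) = p.
Proof. by apply/polyP => i; rewrite coef_pre coef_map. Qed.
Lemma pim_map (p : {poly R}) : pim (map_poly rc p) = 0.
Proof. by apply/polyP => i; rewrite coef_pim coef_map coef0. Qed.

Lemma poly_parts H :
  H = map_poly rc (pre H) + (Complex 0 1)%:P * map_poly rc (pim H).
Proof.
apply/polyP => i; rewrite coefD coefCM !(coef_map rc) coef_pre coef_pim.
by rewrite {1}[H`_i]complexE.
Qed.

Lemma hornerC_parts H t : H.[t%:C%C] = Complex (pre H).[t] (pim H).[t].
Proof.
rewrite {1}(poly_parts H) hornerD hornerM hornerC !horner_map /=.
by apply/eqP; rewrite eq_complex /=; apply/andP; split; apply/eqP; ring.
Qed.

Lemma pre_factor t m K :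
  pre (('X - t%:C%C%:P) ^+ m * K) = ('X - t%:P) ^+ m * pre K.
Proof.
have -> : ('X - t%:C%C%:P) ^+ m = map_poly rc (('X - t%:P) ^+ m).
  by rewrite rmorphXn rmorphB /= map_polyX map_polyC.
by rewrite pre_mul pre_map pim_map mul0r subr0.
Qed.

Lemma pim_factor t m K :
  pim (('X - t%:C%C%:P) ^+ m * K) = ('X - t%:P) ^+ m * pim K.
Proof.
have -> : ('X - t%:C%C%:P) ^+ m = map_poly rc (('X - t%:P) ^+ m).
  by rewrite rmorphXn rmorphB /= map_polyX map_polyC.
by rewrite pim_mul pre_map pim_map mulr0 addr0.
Qed.

(* The line tangent to the curve [H] at parameter [t] is spanned by [u], also
   when [H] vanishes at [t]. *)
Definition direction H t (u : C) : Prop :=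
  exists m K, [/\ H = ('X - t%:C%C%:P) ^+ m * K, K.[t%:C%C] = u & u != 0].

Lemma direction_exists H t : H != 0 -> exists u, direction H t u.
Proof.
move=> H0; have [K HE Kt] := mup_cofactor t%:C%C H0.
by exists K.[t%:C%C]; exists (mup t%:C%C H), K.
Qed.

(** The endpoint correction $k$, equal to $\psi(uv)-\psi(u)-\psi(v)$ for the sawtooth $\psi$.
    Scaling [u] and [v] by nonzero reals multiplies the argument of [sg] by a positive square. *)
Definition cocycle (u v : C) : R := 2^-1 * Num.sg (Im u * Im v * Im (u * v)).

(** Splitting off the powers of $T-t$ reduces to curves that do not vanish at [t]; these powers
    enter the last sign squared and leave it unchanged. *)
Lemma Indside_mulC b t H1 H2 u1 u2 :
  direction H1 t u1 -> direction H2 t u2 ->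
  Indside b t (pre (H1 * H2)) (pim (H1 * H2)) =
  Indside b t (pre H1) (pim H1) + Indside b t (pre H2) (pim H2)
  + (cocycle u1 u2 - 2^-1 * sgside b t (pim H1 * pim H2 * pim (H1 * H2))).
Proof.
move=> [m1 [K1 [-> e1 n1]]] [m2 [K2 [-> e2 n2]]].
rewrite mulrACA -exprD !pre_factor !pim_factor !Indside_scale.
have -> W1 W2 W3 : ('X - t%:P) ^+ m1 * W1 * (('X - t%:P) ^+ m2 * W2) *
   (('X - t%:P) ^+ (m1 + m2) * W3) =
   ('X - t%:P) ^+ (m1 + m2) * ('X - t%:P) ^+ (m1 + m2) * (W1 * W2 * W3) :> {poly R}.
  by rewrite exprD; ring.
have X0 : ('X - t%:P) ^+ (m1 + m2) != 0 :> {poly R} by rewrite expf_neq0 // polyXsubC_eq0.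
rewrite 2!sgsideM sgside_sqr // mul1r.
have nz K u : K.[t%:C%C] = u -> u != 0 -> ((pre K).[t] != 0) || ((pim K).[t] != 0).
  by move=> <-; rewrite hornerC_parts -negb_and; apply: contra; rewrite eq_complex.
rewrite pre_mul pim_mul (Indside_mul _ (nz K1 u1 e1 n1) (nz K2 u2 e2 n2)).
rewrite /cocycle -e1 -e2 -(hornerM K1 K2) !hornerC_parts /= pim_mul.
by rewrite -mulrBr.
Qed.

Definition IndC (a b : R) H : R := Ind_lt a b (pre H) (pim H).

(** At an inner point the correction enters from the right and from the left with opposite signs and
    cancels, while the one-sided signs of [W] telescope over the segment. Only the corrections at
    [a] and [b] remain. *)
Lemma IndC_mul a b H1 H2 u1 u2 v1 v2 : a < b ->
  direction H1 a u1 -> direction H2 a u2 ->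
  direction H1 b v1 -> direction H2 b v2 ->
  IndC a b (H1 * H2) = IndC a b H1 + IndC a b H2 + cocycle u1 u2 - cocycle v1 v2.
Proof.
move=> ab dHu1 dHu2 dHv1 dHv2.
have nz0 H t u : direction H t u -> H != 0.
  move=> [m [K [-> e u0]]]; rewrite mulf_neq0 ?expf_neq0 ?polyXsubC_eq0 //.
  by apply: contraNneq u0 => K0; rewrite -e K0 horner0.
have H10 := nz0 _ _ _ dHu1; have H20 := nz0 _ _ _ dHu2.
rewrite /IndC /Ind_lt !IndpE !IndmE.
rewrite (Indside_mulC _ dHu1 dHu2) (Indside_mulC _ dHv1 dHv2).
set W := pim H1 * pim H2 * pim (H1 * H2).
(* [roots] of the zero polynomial is empty, so zero factors are replaced by 1: the roots of [Q] then
   include those of each nonzero polynomial among the three. *)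
pose nz (Q : {poly R}) := if Q == 0 then 1 else Q.
have nzn Q : nz Q != 0 by rewrite /nz; case: ifPn; rewrite ?oner_eq0.
pose Q := nz (pim H1) * nz (pim H2) * nz (pim (H1 * H2)).
have Q0 : Q != 0 by rewrite !mulf_neq0.
pose s := roots Q a b.
have sub P : P \in [:: pim H1; pim H2; pim (H1 * H2)] -> P != 0 ->
    {in `]a, b[, forall x, root P x -> x \in s}.
  rewrite !inE => h P0 x xab rx; rewrite /s in_roots Q0 xab andbT /Q !rootM.
  have : root (nz P) x by rewrite /nz (negbTE P0).
  by case/or3P: h => /eqP <- ->; rewrite ?orbT.
have us : uniq s by exact: uniq_roots.
have sab : {subset s <= `]a, b[} by move=> x; apply: roots_in.
rewrite !(@sum_Indx _ s) //; try by apply: sub; rewrite !inE eqxx ?orbT.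
have tel : sgside false a W + \sum_(x <- s) (sgside false x W - sgside true x W)
    = sgside true b W.
  have [->|W0] := eqVneq W 0.
    by rewrite !sgside0 big1 ?addr0 // => x _; rewrite !sgside0 subrr.
  apply: sgside_telescope => //.
  - exact: path_roots.
  - by apply/allP => x /sab; rewrite in_itv /= => /andP[].
  move: W0; rewrite /W !mulf_eq0 !negb_or => /andP[/andP[? ?] ?] x xab.
  by rewrite !rootM => /orP[/orP[]|]; apply: sub; rewrite ?inE ?eqxx ?orbT.
have -> : \sum_(x <- s) Indx x (pre (H1 * H2)) (pim (H1 * H2)) =
    \sum_(x <- s) Indx x (pre H1) (pim H1) + \sum_(x <- s) Indx x (pre H2) (pim H2)
    - 2^-1 * \sum_(x <- s) (sgside false x W - sgside true x W).
  rewrite mulr_sumr -big_split -sumrB /=; apply: eq_bigr => x _.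
  have [w1 d1] := direction_exists x H10.
  have [w2 d2] := direction_exists x H20.
  by rewrite !IndxE !(Indside_mulC _ d1 d2) -/W; ring.
by move: tel => /(canRL (addKr _)) ->; rewrite -/W; ring.
Qed.

End ComplexParts.

(** * Tangent directions along lines, and explicit indices *)

Section Winding.
Variable R : rcfType.
Local Notation C := (complex R).
Local Notation Re := (@complex.Re R).
Local Notation Im := (@complex.Im R).
Local Notation conj := (@conjc R).
Local Notation "''i'" := (Complex 0 1 : C).
Implicit Types (F G H K : {poly C}) (t : R) (z v : C).

(** The first nonzero Taylor coefficient of [F] at [z], for [F != 0]. *)
Definition lowcoef z F : C := (F %/ ('X - z%:P) ^+ mup z F).[z].

Lemma lowcoefP z F : F != 0 ->
  exists K, F = ('X - z%:P) ^+ mup z F * K /\ K.[z] = lowcoef z F.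
Proof.
move=> F0; exists (F %/ ('X - z%:P) ^+ mup z F); split => //.
by rewrite mulrC divpK // -mup_geq.
Qed.

Lemma lowcoef_neq0 z F : F != 0 -> lowcoef z F != 0.
Proof.
move=> F0; have [K FE Kz] := mup_cofactor z F0.
by rewrite /lowcoef {1}FE mulrC mulpK // expf_neq0 // polyXsubC_eq0.
Qed.

Lemma comp_line z (m : nat) K (a b : C) t : z = a + b * t%:C%C ->
  (('X - z%:P) ^+ m * K) \Po (a%:P + b%:P * 'X) =
  ('X - t%:C%C%:P) ^+ m * (b ^+ m *: (K \Po (a%:P + b%:P * 'X))).
Proof.
move=> zE; rewrite comp_polyM rmorphXn /= comp_polyB comp_polyX comp_polyC.
have -> : a%:P + b%:P * 'X - z%:P = b%:P * ('X - t%:C%C%:P).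
  by rewrite zE polyCD polyCM; ring.
by rewrite exprMn -polyC_exp -mul_polyC; ring.
Qed.

(** Lowest coefficient of $F\overline G$ along a line through [z] with direction [b]. *)
Definition vdir (b : C) F G z : C :=
  b ^+ mup z F * lowcoef z F * conj (b ^+ mup z G * lowcoef z G).

(** As [t] is real, the conjugate line passes through [conj z] at the same parameter, so the
    multiplicities of [F] and [G] at [z] add up. *)
Lemma line_direction F G (a b : C) t z : F != 0 -> G != 0 -> b != 0 ->
  z = a + b * t%:C%C -> direction (line_poly F G a b) t (vdir b F G z).
Proof.
move=> F0 G0 b0 zE.
have [F1 [FE F1z]] := lowcoefP z F0; have [G1 [GE G1z]] := lowcoefP z G0.
have zE' : conj z = conj a + conj b * t%:C%C.
  by rewrite zE rmorphD rmorphM /= oppr0.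
exists (mup z F + mup z G)%N.
exists (b ^+ mup z F *: (F1 \Po (a%:P + b%:P * 'X)) *
  (conj b ^+ mup z G *: (map_poly conj G1 \Po ((conj a)%:P + (conj b)%:P * 'X)))).
split; last by rewrite !mulf_neq0 ?conjc_eq0 ?mulf_neq0 ?expf_neq0 ?lowcoef_neq0.
  rewrite /line_poly {1}FE {1}GE (comp_line _ _ zE).
  rewrite rmorphM /= rmorphXn /= rmorphB /= map_polyX map_polyC /= (comp_line _ _ zE').
  by rewrite exprD mulrACA.
rewrite hornerM !hornerZ !horner_comp !hornerD !hornerM !hornerC !hornerX -zE -zE'.
by rewrite horner_map /= F1z G1z /vdir rmorphM rmorphXn.
Qed.

Lemma line_polyM F1 F2 G1 G2 (a b : C) :
  line_poly (F1 * F2) (G1 * G2) a b = line_poly F1 G1 a b * line_poly F2 G2 a b.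
Proof.
by rewrite /line_poly !comp_polyM [map_poly _ (_ * _)]rmorphM comp_polyM mulrACA.
Qed.

Lemma cocycle_scale (e1 e2 : R) (u1 u2 : C) : e1 != 0 -> e2 != 0 ->
  cocycle (e1%:C%C * u1) (e2%:C%C * u2) = cocycle u1 u2.
Proof.
move=> n1 n2; have ImZ (e : R) u : Im (e%:C%C * u) = e * Im u.
  by case: u => x y; rewrite /= mul0r addr0.
rewrite /cocycle mulrACA -rmorphM !ImZ; congr (_ * _).
have -> : e1 * Im u1 * (e2 * Im u2) * (e1 * e2 * Im (u1 * u2)) =
  (e1 * e2) ^+ 2 * (Im u1 * Im u2 * Im (u1 * u2)) by ring.
by rewrite sgrM gtr0_sg ?mul1r // exprn_even_gt0 //= mulf_neq0.
Qed.

(** What multiplicativity requires at a vertex: the horizontal and the vertical side give the same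
    correction. Even valuations suffice, but $Z-z$ multiplied by itself also qualifies. *)
Definition compatible F1 G1 F2 G2 v : Prop :=
  cocycle (vdir 1 F1 G1 v) (vdir 1 F2 G2 v) =
  cocycle (vdir 'i F1 G1 v) (vdir 'i F2 G2 v).

Lemma even_vdir F G v : (2 %| valC v F G)%Z ->
  exists2 e : R, e != 0 & vdir 'i F G v = e%:C%C * vdir 1 F G v.
Proof.
rewrite /valC /vdir; set j := 'i; rewrite !rmorphM !rmorphXn /=.
move: (mup v F) (mup v G) => m n ev.
(* From $i^m\,\overline{i}^{\,n}=(-1)^n i^{m+n}$, where $m+n$ is even like $m-n$. *)
exists ((-1) ^+ n * (-1) ^+ (m + n)./2); first by rewrite mulf_neq0 // signr_eq0.
have -> : Complex 1 (- 0) = 1 :> C by rewrite oppr0.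
have -> : Complex 0 (- 1) = -1 * j.
  by apply/eqP; rewrite eq_complex /=; apply/andP; split; apply/eqP; ring.
have j2 : j ^+ 2 = -1.
  by apply/eqP; rewrite eq_complex /=; apply/andP; split; apply/eqP; ring.
have {}ev : ~~ odd (m + n) by move: ev; rewrite -dvdn2; lia.
have jmn : j ^+ m * j ^+ n = (-1) ^+ (m + n)./2.
  by rewrite -exprD -[in LHS](even_halfK ev) -mul2n exprM j2.
rewrite rmorphM !rmorphXn rmorphN rmorph1 !expr1n !mul1r exprMn.
by rewrite -jmn; ring.
Qed.

Lemma even_compatible F1 G1 F2 G2 v :
  (2 %| valC v F1 G1)%Z -> (2 %| valC v F2 G2)%Z -> compatible F1 G1 F2 G2 v.
Proof.
move=> /even_vdir[e1 n1 E1] /even_vdir[e2 n2 E2].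
by rewrite /compatible E1 E2 cocycle_scale.
Qed.

Lemma mup1 z : mup z (1 : {poly C}) = 0%N.
Proof. by rewrite mupNroot // root1. Qed.

Lemma mup_XsubC z v : mup v ('X - z%:P : {poly C}) = (z == v).
Proof. by rewrite -['X - _]expr1 mup_XsubCX; case: eqP. Qed.

(* The directions of the two sides at [z] are [1] and ['i], whose squares are
   both real. *)
Lemma XsubC_compatible z v : compatible ('X - z%:P) 1 ('X - z%:P) 1 v.
Proof.
have [<-|zv] := eqVneq z v; last first.
  by apply: even_compatible; rewrite /valC mup1 mup_XsubC (negbTE zv).
have vE b : vdir b ('X - z%:P) 1 z = b.
  rewrite /vdir /lowcoef mup1 mup_XsubC eqxx !expr1 !expr0 divp1 hornerC.
  rewrite mul1r conjc1 mulr1.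
  by rewrite divpp ?polyXsubC_eq0 // hornerC mulr1.
have c0 u : Im (u * u) = 0 -> cocycle u u = 0.
  by rewrite /cocycle => ->; rewrite mulr0 sgr0 mulr0.
by rewrite /compatible !vE !c0 ?mulr1 //= !mulr0 !mul0r addr0.
Qed.

Definition hline F G (y : R) := line_poly F G (Complex 0 y) (Complex 1 0).
Definition vline F G (x : R) := line_poly F G (Complex x 0) (Complex 0 1).

Lemma wind_IndC F G (x0 x1 y0 y1 : R) : x0 < x1 -> y0 < y1 ->
  wind F G x0 x1 y0 y1 =
  2^-1 * (IndC x0 x1 (hline F G y0) + IndC y0 y1 (vline F G x1)
        - IndC x0 x1 (hline F G y1) - IndC y0 y1 (vline F G x0)).
Proof.
move=> x01 y01; rewrite /wind /Ind x01 y01.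
by rewrite !ltNge !ltW.
Qed.

Lemma hline_direction F G x y : F != 0 -> G != 0 ->
  direction (hline F G y) x (vdir 1 F G (Complex x y)).
Proof.
move=> F0 G0; apply: line_direction; rewrite ?oner_eq0 //.
by apply/eqP; rewrite eq_complex /=; apply/andP; split; apply/eqP; ring.
Qed.

Lemma vline_direction F G x y : F != 0 -> G != 0 ->
  direction (vline F G x) y (vdir 'i F G (Complex x y)).
Proof.
move=> F0 G0; apply: line_direction; rewrite // ?eq_complex /= ?oner_eq0 ?andbF //.
by apply/eqP; rewrite eq_complex /=; apply/andP; split; apply/eqP; ring.
Qed.

Lemma Ind_lt_const (a b : R) (P : {poly R}) (c : R) : Ind_lt a b P c%:P = 0.
Proof.
have Ind0 e x : Indside e x P c%:P = 0.
  rewrite /Indside; have [->|c0] := eqVneq c 0; first by rewrite eqxx andbF.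
  by rewrite (@mupNroot _ _ c%:P) ?rootC // ltn0 !andbF.
by rewrite /Ind_lt IndpE IndmE !Ind0 rootsC big_nil subr0 addr0.
Qed.

(** One-dimensional weight: its product over the two coordinates of [z] is $c_\Gamma(z)$ in the
    rectangle and 0 outside. *)
Definition edge_weight (a b d : R) : R :=
  if a < d < b then 1 else if (d == a) || (d == b) then 2^-1 else 0.

Lemma edge_weight_sg (a b d : R) : a < b ->
  2^-1 * (Num.sg (b - d) - Num.sg (a - d)) = edge_weight a b d.
Proof.
move=> ab.
have sgB (x y : R) : Num.sg (x - y) =
    if y < x then 1 else if x < y then -1 else 0.
  case: (ltrgtP y x) => [h|h|->]; last by rewrite subrr sgr0.
    by rewrite gtr0_sg // subr_gt0.
  by rewrite ltr0_sg // subr_lt0.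
rewrite /edge_weight !sgB.
case: (ltrgtP a d) => ad; case: (ltrgtP d b) => db /=; lra.
Qed.

(** At [d] the right index is [sg c / 2] and the left index its opposite, so [d] counts fully inside
    the segment and one half at an end. *)
Lemma Ind_lt_XsubC (a b c d : R) : a < b ->
  Ind_lt a b c%:P ('X - d%:P) = Num.sg c * edge_weight a b d.
Proof.
move=> ab.
have IndE e x : Indside e x c%:P ('X - d%:P) =
    if x == d then 2^-1 * (Num.sg c * (-1) ^+ e) else 0.
  have [->|c0] := eqVneq c 0.
    by rewrite /Indside eqxx sgr0 mul0r mulr0 if_same.
  rewrite Indside_val ?hornerC ?c0 // hornerXsubC subr_eq0.
  case: eqP => // ->; congr (_ * (_ * _)).
  rewrite -['X - _]mulr1 -['X - _]expr1 sgside_factor hornerC ?oner_eq0 //.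
  by rewrite sgr1 mulr1.
pose s := if a < d < b then [:: d] else [::].
have sE x : (x \in s) = (x == d) && (a < d < b).
  by rewrite /s; case: ifP => _; rewrite ?inE ?andbT ?andbF.
rewrite /Ind_lt (@sum_Indx _ s).
- have -> : \sum_(x <- s) Indx x c%:P ('X - d%:P) = if a < d < b then Num.sg c else 0.
    rewrite /s; case: ifP => _; rewrite ?big_nil // big_seq1 IndxE !IndE eqxx.
    by rewrite expr0 expr1; field.
  rewrite IndpE IndmE !IndE /edge_weight expr0 expr1 ![_ == d]eq_sym.
  case: (ltrgtP a d) => ad; case: (ltrgtP d b) => db /=; try by field.
  by rewrite ad db ltxx in ab.
- by rewrite /s; case: ifP.
- by move=> x; rewrite sE => /andP[/eqP ->]; rewrite in_itv.
by move=> _ x; rewrite in_itv /= root_XsubC sE => xab /eqP <-; rewrite eqxx.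
Qed.

Lemma pre_lin (c d : C) : pre (c%:P + d%:P * 'X) = (Re c)%:P + (Re d)%:P * 'X.
Proof.
apply/polyP => i; rewrite coef_pre !coefD !coefCM !coefC !coefX.
by case: i => [|[|i]]; rewrite /= ?mulr0 ?mulr1 ?addr0 ?add0r.
Qed.

Lemma pim_lin (c d : C) : pim (c%:P + d%:P * 'X) = (Im c)%:P + (Im d)%:P * 'X.
Proof.
apply/polyP => i; rewrite coef_pim !coefD !coefCM !coefC !coefX.
by case: i => [|[|i]]; rewrite /= ?mulr0 ?mulr1 ?addr0 ?add0r.
Qed.

Lemma line_poly_XsubC z (a b : C) :
  line_poly ('X - z%:P) 1 a b = (a - z)%:P + b%:P * 'X.
Proof.
rewrite /line_poly rmorph1 !comp_polyC mulr1 comp_polyB comp_polyX comp_polyC.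
by rewrite polyCB addrAC.
Qed.

Lemma pim_conj H : pim (H * map_poly conj H) = 0.
Proof.
have -> : map_poly conj H = map_poly (real_complex R) (pre H)
    - (Complex 0 1)%:P * map_poly (real_complex R) (pim H).
  apply/polyP => i; rewrite coefB coefCM !(coef_map (real_complex R)).
  rewrite coef_pre coef_pim coef_map.
  case: H`_i => x y; apply/eqP; rewrite eq_complex /=.
  by apply/andP; split; apply/eqP; ring.
rewrite {1}(poly_parts H); set p := map_poly _ _; set q := map_poly _ _.
have -> : (p + (Complex 0 1)%:P * q) * (p - (Complex 0 1)%:P * q) =
   map_poly (real_complex R) (pre H ^+ 2 + pim H ^+ 2).
  rewrite rmorphD !rmorphXn -/p -/q.
  have -> : (p + (Complex 0 1)%:P * q) * (p - (Complex 0 1)%:P * q) =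
    p ^+ 2 - ((Complex 0 1)%:P * (Complex 0 1)%:P) * q ^+ 2 by ring.
  rewrite -polyCM; have -> : Complex 0 1 * Complex 0 1 = - 1 :> C.
    by apply/eqP; rewrite eq_complex /=; apply/andP; split; apply/eqP; ring.
  by rewrite polyCN; ring.
exact: pim_map.
Qed.

Lemma pim_line_self K (a b : C) : pim (line_poly K K a b) = 0.
Proof.
rewrite /line_poly; have -> : map_poly conj K \Po ((conj a)%:P + (conj b)%:P * 'X) =
    map_poly conj (K \Po (a%:P + b%:P * 'X)); last exact: pim_conj.
by rewrite map_comp_poly rmorphD rmorphM /= !map_polyC map_polyX.
Qed.

(** * Winding number around the rectangle: multiplicativity and linear factors *)

Section Rectangle.
Variables (x0 x1 y0 y1 : R).
Hypotheses (x01 : x0 < x1) (y01 : y0 < y1).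
Local Notation w F G := (wind F G x0 x1 y0 y1).

Definition vertices : seq C :=
  [:: Complex x0 y0; Complex x1 y0; Complex x1 y1; Complex x0 y1].

(** Each vertex ends one side and starts the next, and compatibility makes its two corrections
    equal, so they cancel around the boundary. *)
Lemma wind_mul F1 G1 F2 G2 : F1 != 0 -> G1 != 0 -> F2 != 0 -> G2 != 0 ->
  {in vertices, forall v, compatible F1 G1 F2 G2 v} ->
  w (F1 * F2) (G1 * G2) = w F1 G1 + w F2 G2.
Proof.
move=> F10 G10 F20 G20 cmp; rewrite !wind_IndC // /hline /vline !line_polyM.
rewrite -/(hline _ _ _) -/(vline _ _ _).
have [k [hM vM]] : exists k : C -> R,
   (forall y, IndC x0 x1 (hline F1 G1 y * hline F2 G2 y) = IndC x0 x1 (hline F1 G1 y)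
       + IndC x0 x1 (hline F2 G2 y) + k (Complex x0 y) - k (Complex x1 y)) /\
   (forall x, Complex x y0 \in vertices -> Complex x y1 \in vertices ->
      IndC y0 y1 (vline F1 G1 x * vline F2 G2 x) = IndC y0 y1 (vline F1 G1 x)
       + IndC y0 y1 (vline F2 G2 x) + k (Complex x y0) - k (Complex x y1)).
  (* Horizontal directions define [k]; compatibility makes it valid on the vertical sides too. *)
  exists (fun v => cocycle (vdir 1 F1 G1 v) (vdir 1 F2 G2 v)); split => [y|x v0 v1].
    by apply: IndC_mul => //; apply: hline_direction.
  rewrite (cmp _ v0) (cmp _ v1).
  by apply: IndC_mul => //; apply: vline_direction.
have [v00 v10 v11 v01] : [/\ Complex x0 y0 \in vertices, Complex x1 y0 \in vertices,
    Complex x1 y1 \in vertices & Complex x0 y1 \in vertices].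
  by rewrite !inE !eqxx ?orbT.
rewrite !hM (vM x0) // (vM x1) //.
move: (IndC x0 x1 (hline F1 G1 y0)) (IndC x0 x1 (hline F1 G1 y1))
  (IndC y0 y1 (vline F1 G1 x0)) (IndC y0 y1 (vline F1 G1 x1))
  (IndC x0 x1 (hline F2 G2 y0)) (IndC x0 x1 (hline F2 G2 y1))
  (IndC y0 y1 (vline F2 G2 x0)) (IndC y0 y1 (vline F2 G2 x1)) => *; ring.
Qed.

Lemma wind_self K : w K K = 0.
Proof.
rewrite wind_IndC // /IndC /hline /vline !pim_line_self.
by rewrite -polyC0 !Ind_lt_const !subr0 addr0 mulr0.
Qed.

Lemma wind_const (c d : C) : w c%:P d%:P = 0.
Proof.
have pim_const a b : pim (line_poly c%:P d%:P a b) = (Im (c * conj d))%:P.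
  rewrite /line_poly map_polyC /= !comp_polyC -polyCM.
  by apply/polyP => i; rewrite coef_pim !coefC; case: eqP.
rewrite wind_IndC // /IndC /hline /vline !pim_const !Ind_lt_const.
by rewrite !subr0 addr0 mulr0.
Qed.

(** Horizontal sides contribute 0, the imaginary part being constant there. The vertical sides
    contribute the weight of [Im z] with the signs of [x1 - Re z] and [x0 - Re z]. A vertex [z] is
    allowed. *)
Lemma wind_XsubC z :
  w ('X - z%:P) 1 = edge_weight x0 x1 (Re z) * edge_weight y0 y1 (Im z).
Proof.
case: z => a b /=.
have hE y : IndC x0 x1 (hline ('X - (Complex a b)%:P) 1 y) = 0.
  by rewrite /IndC /hline line_poly_XsubC pim_lin /= mul0r addr0 Ind_lt_const.
have vE x : IndC y0 y1 (vline ('X - (Complex a b)%:P) 1 x) =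
    Num.sg (x - a) * edge_weight y0 y1 b.
  rewrite /IndC /vline line_poly_XsubC pim_lin pre_lin /= mul0r addr0 mul1r.
  by rewrite sub0r polyCN [- _ + _]addrC Ind_lt_XsubC.
rewrite wind_IndC // !hE !vE -(edge_weight_sg a x01); ring.
Qed.

(** * The weighted count of zeros and poles *)

Definition weighted_count F G : R :=
  \sum_(z \in rect x0 x1 y0 y1) (cGamma x0 x1 y0 y1 z * (valC z F G)%:~R).

Lemma edge_weight_out (a b d : R) : a < b -> ~ (a <= d <= b) -> edge_weight a b d = 0.
Proof.
move=> ab h; have : d < a \/ b < d.
  by apply/orP; rewrite -[_ || _]negbK negb_or -!leNgt; apply/negP.
rewrite /edge_weight; case=> hd.
  by rewrite (lt_eqF hd) (lt_eqF (lt_trans hd ab)) [a < d]lt_gtF.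
by rewrite (gt_eqF hd) (gt_eqF (lt_trans ab hd)) [d < b]lt_gtF // andbF.
Qed.

Lemma poly_roots_seq F : F != 0 -> exists s : seq C, forall z, root F z -> z \in s.
Proof.
move=> F0; have [s ->] := closed_field_poly_normal F; exists s => z.
by rewrite rootZ ?lead_coef_eq0 // root_prod_XsubC.
Qed.

(** The valuation vanishes off the roots, so the sum over the infinite rectangle becomes one over a
    finite set, which can be shared by several quotients and split. *)
Lemma weighted_count_restrict (s : seq C) F G : (forall z, root (F * G) z -> z \in s) ->
  weighted_count F G = \sum_(z \in (rect x0 x1 y0 y1 `&` [set` s])%classic)
    (cGamma x0 x1 y0 y1 z * (valC z F G)%:~R).
Proof.
move=> rs; symmetry; apply: fsbig_widen; first by move=> z [].
move=> z /= [zr nz]; have zs : z \notin s by apply/negP => zs; apply: nz.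
have := contra (rs z) zs; rewrite rootM negb_or => /andP[rF rG].
by rewrite /valC !mupNroot // subrr mulr0.
Qed.

Lemma valC_mul F1 G1 F2 G2 z : F1 != 0 -> G1 != 0 -> F2 != 0 -> G2 != 0 ->
  valC z (F1 * F2) (G1 * G2) = valC z F1 G1 + valC z F2 G2.
Proof. by move=> *; rewrite /valC !mupM // !PoszD; ring. Qed.

Lemma weighted_count_mul F1 G1 F2 G2 :
  F1 != 0 -> G1 != 0 -> F2 != 0 -> G2 != 0 ->
  weighted_count (F1 * F2) (G1 * G2) = weighted_count F1 G1 + weighted_count F2 G2.
Proof.
move=> F10 G10 F20 G20.
have [|s rs] := @poly_roots_seq (F1 * F2 * (G1 * G2)); first by rewrite !mulf_neq0.
rewrite !(@weighted_count_restrict s); first 1 last.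
- by move=> z h; apply: rs; move: h; rewrite !rootM => /orP[] ->; rewrite ?orbT.
- by move=> z h; apply: rs; move: h; rewrite !rootM => /orP[] ->; rewrite ?orbT.
- exact: rs.
rewrite -fsbig_split /=; last by apply: finite_setIr; apply: finite_seq.
by apply: eq_fsbigr => z _; rewrite valC_mul // rmorphD mulrDr.
Qed.

Lemma weighted_count_eq0 F G : (forall z, valC z F G = 0) -> weighted_count F G = 0.
Proof. by move=> h; apply: fsbig1 => z _; rewrite h mulr0. Qed.

Lemma weighted_count_XsubC z :
  weighted_count ('X - z%:P) 1 = edge_weight x0 x1 (Re z) * edge_weight y0 y1 (Im z).
Proof.
have valE v : valC v ('X - z%:P) 1 = (z == v)%:Z by rewrite /valC mup1 mup_XsubC subr0.
have [zr|zr] := pselect (rect x0 x1 y0 y1 z); last first.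
  transitivity (0 : R).
    apply: fsbig1 => v vr; rewrite valE; case: eqP => [zv|]; last by rewrite mulr0.
    by case: zr; rewrite zv.
  have [xr|/negP xr] := boolP (x0 <= Re z <= x1); last by rewrite edge_weight_out ?mul0r.
  have [yr|/negP yr] := boolP (y0 <= Im z <= y1); last first.
    by rewrite mulrC edge_weight_out ?mul0r.
  by case: zr.
transitivity (\sum_(v \in [set z]%classic)
    (cGamma x0 x1 y0 y1 v * (valC v ('X - z%:P) 1)%:~R)).
  symmetry; apply: fsbig_widen; first by move=> v ->.
  by move=> v /= [_ vz]; rewrite valE; case: eqP => [zv|]; [case: vz|rewrite mulr0].
rewrite fsbig_set1 valE eqxx mulr1.
case: z zr {valE} => a b; rewrite /rect /cGamma /edge_weight /=.
move=> -[/andP[xa ax] /andP[yb bx]].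
have x10 : (x0 == x1) = false by rewrite lt_eqF.
have y10 : (y0 == y1) = false by rewrite lt_eqF.
move: xa ax yb bx.
case: (ltrgtP x0 a) => xa //; case: (ltrgtP a x1) => ax //;
case: (ltrgtP y0 b) => yb //; case: (ltrgtP b y1) => bx // _ _ _ _;
rewrite ?mulr1 ?mul1r //=; try (by field);
by move: x10 y10; rewrite ?xa ?ax ?yb ?bx ?eqxx.
Qed.

(** * Parity at the vertices and induction on the degrees *)

Definition vertex_even F G := {in vertices, forall v, (2 %| valC v F G)%Z}.

Lemma wind_even_mul F1 G1 F2 G2 : F1 != 0 -> G1 != 0 -> F2 != 0 -> G2 != 0 ->
  vertex_even F1 G1 -> vertex_even F2 G2 ->
  w (F1 * F2) (G1 * G2) = w F1 G1 + w F2 G2.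
Proof.
move=> F10 G10 F20 G20 e1 e2; apply: (wind_mul F10 G10 F20 G20) => v vv.
exact: even_compatible (e1 v vv) (e2 v vv).
Qed.

Lemma vertex_even_cancel F1 G1 F2 G2 : F1 != 0 -> G1 != 0 -> F2 != 0 -> G2 != 0 ->
  vertex_even (F1 * F2) (G1 * G2) -> vertex_even F2 G2 -> vertex_even F1 G1.
Proof.
move=> F10 G10 F20 G20 e12 e2 v vv.
by have := e12 v vv; rewrite valC_mul // rpredDr //; apply: e2.
Qed.

Lemma valC_self K z : valC z K K = 0.
Proof. by rewrite /valC subrr. Qed.

Lemma vertex_even_self K : vertex_even K K.
Proof. by move=> v _; rewrite valC_self. Qed.

Lemma valC_anti F G z : valC z G F = - valC z F G.
Proof. by rewrite /valC opprB. Qed.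

Lemma vertex_even_anti F G : vertex_even F G -> vertex_even G F.
Proof. by move=> e v vv; rewrite valC_anti rpredN; apply: e. Qed.

(** Serves for a vertex [z], where $Z-z$ has odd valuation and only its square can be split off.
    Both sides are twice their values for $Z-z$. *)
Lemma wind_XsubC_sqr z :
  w (('X - z%:P) ^+ 2) 1 = weighted_count (('X - z%:P) ^+ 2) 1.
Proof.
have X0 : 'X - z%:P != 0 :> {poly C} by rewrite polyXsubC_eq0.
have n1 : 1 != 0 :> {poly C} by rewrite oner_eq0.
have := wind_mul X0 n1 X0 n1 (fun v _ => XsubC_compatible z v).
have := weighted_count_mul X0 n1 X0 n1.
by rewrite mulr1 -expr2 => -> ->; rewrite wind_XsubC weighted_count_XsubC.
Qed.

Lemma wind_count F G : F != 0 -> G != 0 -> vertex_even F G ->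
  w F G = weighted_count F G.
Proof.
have [n] := ubnP (size F + size G); elim: n => // n IH in F G *.
have X0 z : 'X - z%:P != 0 :> {poly C} by rewrite polyXsubC_eq0.
(* A quotient [A / B] with even valuations at the vertices and known formula is split off; the rest
   is smaller and again has even valuations there. *)
have step F' G' A B : F' * A != 0 -> G' * B != 0 -> (size F' + size G' < n)%N ->
    vertex_even (F' * A) (G' * B) -> vertex_even A B ->
    w A B = weighted_count A B ->
    w (F' * A) (G' * B) = weighted_count (F' * A) (G' * B).
  rewrite !mulf_eq0 !negb_or => /andP[F'0 A0] /andP[G'0 B0] lt_sz eFG eAB wAB.
  have eF'G' : vertex_even F' G' by apply: vertex_even_cancel eFG eAB.
  by rewrite wind_even_mul // weighted_count_mul // wAB (IH F' G').
(* The bound is [<= n], not [< n], so that this case also serves for the exchanged pair, whose total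
   size is the same. *)
have coprime_case F' G' : (size F' + size G' <= n)%N -> F' != 0 -> G' != 0 ->
    vertex_even F' G' -> (forall z, root F' z -> ~~ root G' z) ->
    (size G' <= size F')%N -> w F' G' = weighted_count F' G'.
  move=> le_n F'0 G'0 ev coFG le_sz.
  have [szF|/closed_rootP[z Fz]] := eqVneq (size F') 1%N.
    have szG : size G' = 1%N.
      by apply/eqP; rewrite eqn_leq -{1}szF le_sz lt0n size_poly_eq0.
    move/eqP/size_poly1P: szF => [c c0 ->]; move/eqP/size_poly1P: szG => [d d0 ->].
    rewrite wind_const weighted_count_eq0 // => v.
    by rewrite /valC !mupNroot ?rootC // subrr.
  have G'1 : G' = G' * 1 by rewrite mulr1.
  have [zv|zv] := boolP (z \in vertices).
    (* [G'] does not vanish at [z], so the multiplicity of [F'] is even and positive, hence at least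
       2. *)
    have : (('X - z%:P) ^+ 2 %| F')%R.
      have := ev z zv; rewrite /valC (mupNroot (coFG z Fz)) subr0 -mup_geq //.
      by move: Fz; rewrite -dvdp_XsubCl XsubC_dvd //; case: mup => [|[|k]].
    case/dvdpP => F1 FE; move: F'0 G'0 le_n ev; rewrite G'1 FE => F'0 G'0 le_n ev.
    apply: step => //; last exact: wind_XsubC_sqr.
      move: F'0 le_n; rewrite mulf_eq0 negb_or mulr1 => /andP[F10 _].
      by rewrite size_Mmonic ?monic_exp ?monicXsubC // size_exp_XsubC; lia.
    by move=> v _; rewrite /valC mup1 mup_XsubCX; case: eqP.
  (* When [z] is no vertex, $Z-z$ has valuation 0 at all vertices and can be split off alone. *)
  have /factor_theorem[F1 FE] := Fz.
  move: F'0 G'0 le_n ev; rewrite G'1 FE => F'0 G'0 le_n ev.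
  apply: step => //; last by rewrite wind_XsubC weighted_count_XsubC.
    move: F'0 le_n; rewrite mulf_eq0 negb_or mulr1 => /andP[F10 _].
    by rewrite size_Mmonic ?monicXsubC // size_XsubC; lia.
  by move=> v vv; rewrite /valC mup1 mup_XsubC; case: eqP => // zE; rewrite zE vv in zv.
rewrite ltnS => le_n F0 G0 ev.
have [[z [Fz Gz]]|nocommon] := pselect (exists z, root F z /\ root G z).
  (* A common root: $(Z-z)/(Z-z)$ is split off, with winding number and count 0. *)
  move: Fz Gz F0 G0 le_n ev.
  move=> /factor_theorem[F' ->] /factor_theorem[G' ->] F0 G0 le_n ev.
  apply: step => //.
  - move: F0 G0 le_n; rewrite !mulf_eq0 !negb_or => /andP[? _] /andP[? _].
    by rewrite !size_Mmonic ?monicXsubC // !size_XsubC; lia.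
  - exact: vertex_even_self.
  - by rewrite wind_self weighted_count_eq0 // => v; rewrite valC_self.
have [le_sz|/ltnW le_sz] := leqP (size G) (size F).
  apply: coprime_case => // z Fz; apply/negP => Gz; apply: nocommon; by exists z.
(* Now [G] has the larger degree. The formula for [G / F] transfers because, on both sides, the
   values for [F / G] and [G / F] add up to 0. *)
have wGF : w G F = weighted_count G F.
  apply: coprime_case => //; first by rewrite addnC.
    exact: vertex_even_anti.
  by move=> z Gz; apply/negP => Fz; apply: nocommon; exists z.
have wFGGF : w F G + w G F = 0.
  rewrite -wind_even_mul //; first by rewrite [G * F]mulrC wind_self.
  exact: vertex_even_anti.
have cFGGF : weighted_count F G + weighted_count G F = 0.
  rewrite -weighted_count_mul // [G * F]mulrC weighted_count_eq0 // => v.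
  by rewrite valC_self.
by apply: (addIr (w G F)); rewrite wFGGF wGF cFGGF.
Qed.

End Rectangle.
End Winding.

Theorem theorem1p13 (R : rcfType) (F G : {poly complex R}) (x0 x1 y0 y1 : R) :
  F != 0 -> G != 0 -> x0 < x1 -> y0 < y1 ->
  (2 %| valC (Complex x0 y0) F G)%Z ->
  (2 %| valC (Complex x1 y0) F G)%Z ->
  (2 %| valC (Complex x1 y1) F G)%Z ->
  (2 %| valC (Complex x0 y1) F G)%Z ->
  wind F G x0 x1 y0 y1 =
  \sum_(z \in rect x0 x1 y0 y1) (cGamma x0 x1 y0 y1 z * (valC z F G)%:~R).
Proof.
move=> F0 G0 x01 y01 ev00 ev10 ev11 ev01.
apply: (wind_count x01 y01 F0 G0) => v.
by rewrite !inE => /or4P[] /eqP ->.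
Qed.
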